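(* Let $[\mathbf{T},\mathbf{o}]$ be a unimodular random rooted ordered Eternal Family Tree such that $\mathbf{T}$ almost surely has a unique succession line. Then there exists a stationary sequence $Y=(Y_n)_{n\in\mathbb{Z}}$ of random variables with values in $\{-1,0,1,2,\dots\}$ such that $[\mathbf{T},\mathbf{o}]$ has the same distribution (as a rooted ordered tree) as $[\mathbb{Z}^R_Y(0),0]$, the connected component of $0$ in the record graph of $Y$, rooted at $0$ with children ordered by the order of $\mathbb{Z}$. In particular such a $Y$ exists whenever $[\mathbf{T},\mathbf{o}]$ is of class $\mathcal{I}/\mathcal{I}$.
   Context: A Family Tree is a directed tree in which every vertex has out-degree at most one (the out-neighbour is the parent $F(u)$); an Eternal Family Tree (EFT) is one where every vertex has out-degree exactly one; all trees are locally finite. An ordered Family Tree has the children of each vertex totally ordered by $<$. The RLS (depth-first) order $\prec$ on vertices: $u\prec v$ if $v=F^k(u)$ for some $k>0$, or if $w=F^m(u)=F^n(v)$ is the first common ancestor (with $m,n\ge1$ minimal) and $F^{m-1}(u)<F^{n-1}(v)$. For a vertex $u$, $b(u)=\max\{v:v\prec u\}$ and $a(u)=\min\{v:v\succ u\}$ when they exist. The succession line through $o$ is $(u_n)_{n\in\mathbb{Z}}$ with $u_0=o$, $u_n=b(u_{n+1})$ for $n<0$ and $u_n=a(u_{n-1})$ for $n>0$ (with $u_n=u_{n+1}$, resp. $u_n=u_{n-1}$, if $b$, resp. $a$, does not exist); its set of vertices $\{u_n\}$ is a succession line of $T$. $T$ has a unique succession line if all these sets coincide, i.e. all vertices lie on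 one succession line. A random rooted network $[\mathbf{G},\mathbf{o}]$ (here marks encode the order) is unimodular if $\mathbb{E}[\sum_{u}h([\mathbf{G},\mathbf{o},u])]=\mathbb{E}[\sum_u h([\mathbf{G},u,\mathbf{o}])]$ for every measurable $h\ge0$ on doubly rooted isomorphism classes. An EFT is of class $\mathcal{I}/\mathcal{I}$ if every foil is infinite, where $u,v$ are in the same foil if $F^n(u)=F^n(v)$ for some $n\ge1$. Record graph: for $y=(y_n)$, $R_y(i)=\inf\{n>i:\sum_{l=i}^{n-1}y_l\ge0\}$ if this set is nonempty, else $i$; edges $i\to R_y(i)$ for $R_y(i)\ne i$; components in the undirected sense. *)

(* Defs.v *)
From HB Require Import structures.
From Stdlib Require Import Relations.
From mathcomp Require Import all_boot all_order all_algebra.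
From mathcomp Require Import all_classical all_reals all_analysis measurable_realfun.
Set Implicit Arguments. Unset Strict Implicit. Unset Printing Implicit Defensive.
Import Order.TTheory GRing.Theory Num.Theory.
Local Open Scope classical_set_scope.
Local Open Scope ring_scope.

(* Labelled rooted ordered (family-)tree structures on the label set   *)
(* int.  A structure s consists of                                    *)
(*   vert s : int -> bool        the vertex set,                       *)
(*   par  s : int -> int         the parent map F (par s v = v encodes *)
(*                               "v has no parent", out-degree 0),     *)
(*   olt  s : int -> int -> bool the order < among children,           *)
(*   root s : int                the root.                             *)
HB.instance Definition _ := isPointed.Build int 0%R.

Definition ostr : Type :=
  ((int -> bool) * (int -> int) * (int -> int -> bool) * int)%type.

Definition vert (s : ostr) : int -> bool := s.1.1.1.
Definition par (s : ostr) : int -> int := s.1.1.2.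
Definition olt (s : ostr) : int -> int -> bool := s.1.2.
Definition root (s : ostr) : int := s.2.
Definition mk_ostr (V : int -> bool) (F : int -> int) (lt : int -> int -> bool)
  (o : int) : ostr := (V, F, lt, o).
Definition reroot (s : ostr) (u : int) : ostr := (s.1, u).

Definition coord_events : set (set ostr) :=
  [set A | (exists v, A = [set s | vert s v])
        \/ (exists v w, A = [set s | par s v = w])
        \/ (exists v w, A = [set s | olt s v w])
        \/ (exists v, A = [set s | root s = v])].

Definition Ostr := g_sigma_algebraType coord_events.

Definition is_oEFT (s : ostr) : Prop :=
  [/\ vert s (root s),
      (forall v, vert s v -> vert s (par s v)),
      (* every vertex has out-degree exactly one, and there are no cycles *)
      (forall v k, vert s v -> (0 < k)%N -> iter k (par s) v <> v),
      (* connected (as an undirected graph) *)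
      (forall u v, vert s u -> vert s v ->
         exists m n, iter m (par s) u = iter n (par s) v) &
      (forall v, vert s v -> finite_set [set u | vert s u /\ par s u = v])] /\
      (forall v,
        let C := [set u | vert s u /\ par s u = v] in
        [/\ (forall u, C u -> ~~ olt s u u),
            (forall u w x, C u -> C w -> C x -> olt s u w -> olt s w x -> olt s u x) &
            (forall u w, C u -> C w -> u <> w -> olt s u w \/ olt s w u)]).

Definition riso (s1 s2 : ostr) (phi : int -> int) : Prop :=
  phi (root s1) = root s2 /\
  [/\ (forall v, vert s1 v -> vert s2 (phi v)),
      (forall v w, vert s1 v -> vert s1 w -> phi v = phi w -> v = w),
      (forall w, vert s2 w -> exists2 v, vert s1 v & phi v = w),
      (forall v, vert s1 v -> phi (par s1 v) = par s2 (phi v)) &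
      (forall u w, vert s1 u -> vert s1 w -> par s1 u = par s1 w ->
         olt s1 u w = olt s2 (phi u) (phi w))].

Definition iso_closed (A : set ostr) : Prop :=
  forall s1 s2 phi, riso s1 s2 phi -> A s1 -> A s2.

Section Random.
Variable R : realType.

(* equality in distribution of the rooted isomorphism classes *)
Definition same_law {d1 d2 : measure_display}
  {T1 : measurableType d1} {T2 : measurableType d2}
  (P1 : probability T1 R) (X1 : T1 -> Ostr)
  (P2 : probability T2 R) (X2 : T2 -> Ostr) : Prop :=
  forall A : set Ostr, measurable A -> iso_closed A ->
    P1 (X1 @^-1` A) = P2 (X2 @^-1` A).

(* unimodularity (mass transport principle); h s u stands for
   h([G, root s, u]) : nonnegative, measurable, and invariant under
   isomorphisms of doubly rooted ordered trees *)
Definition unimodular {d : measure_display} {T : measurableType d}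
  (P : probability T R) (X : T -> Ostr) : Prop :=
  forall h : ostr -> int -> \bar R,
    (forall s u, (0 <= h s u)%E) ->
    (forall u, measurable_fun [set: Ostr] (fun s => h s u)) ->
    (forall s1 s2 phi u, is_oEFT s1 -> is_oEFT s2 -> riso s1 s2 phi ->
       vert s1 u -> h s1 u = h s2 (phi u)) ->
    (\int[P]_w (\esum_(u in [set u | vert (X w) u]) h (X w) u) =
     \int[P]_w (\esum_(u in [set u | vert (X w) u])
                   h (reroot (X w) u) (root (X w))))%E.

End Random.

Definition anc (s : ostr) (u v : int) : Prop :=
  exists k, (0 < k)%N /\ v = iter k (par s) u.

Definition rls (s : ostr) (u v : int) : Prop :=
  anc s u v \/
  exists m n, [/\ (0 < m)%N, (0 < n)%N,
     iter m (par s) u = iter n (par s) v,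
     (forall m' n', (0 < m')%N -> (0 < n')%N ->
        iter m' (par s) u = iter n' (par s) v -> (m <= m')%N /\ (n <= n')%N) &
     olt s (iter m.-1 (par s) u) (iter n.-1 (par s) v)].

Definition is_b (s : ostr) (u v : int) : Prop :=
  [/\ vert s v, rls s v u &
      forall w, vert s w -> rls s w u -> w = v \/ rls s w v].
Definition is_a (s : ostr) (u v : int) : Prop :=
  [/\ vert s v, rls s u v &
      forall w, vert s w -> rls s u w -> w = v \/ rls s v w].

Definition bfun (s : ostr) (u : int) : int := xget u [set v | is_b s u v].
Definition afun (s : ostr) (u : int) : int := xget u [set v | is_a s u v].

Definition sline (s : ostr) (o : int) : set int :=
  [set v | exists n : nat, v = iter n (bfun s) o \/ v = iter n (afun s) o].

Definition unique_succession_line (s : ostr) : Prop :=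
  forall o o', vert s o -> vert s o' -> sline s o = sline s o'.

(* class I/I : every foil is infinite *)
Definition class_II (s : ostr) : Prop :=
  forall u, vert s u ->
    ~ finite_set [set v | vert s v /\
                    exists n, (0 < n)%N /\ iter n (par s) u = iter n (par s) v].

Definition psum (y : int -> int) (i n : int) : int :=
  \sum_(0 <= k < `|n - i|%N) y (i + k%:Z).

Definition rec_cand (y : int -> int) (i : int) : set int :=
  [set n | i < n /\ 0 <= psum y i n].

Definition rec_next (y : int -> int) (i : int) : int :=
  xget i [set n | rec_cand y i n /\ forall m, rec_cand y i m -> n <= m].

Definition rec_edge (y : int -> int) (i j : int) : Prop :=
  rec_next y i = j /\ rec_next y i <> i.

Definition rec_tree (y : int -> int) : ostr :=
  mk_ostr (fun i => `[< clos_refl_sym_trans int (rec_edge y) 0 i >])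
          (rec_next y) (fun i j => i < j) 0.

Definition stationary {d : measure_display} {T : measurableType d}
  {R : realType} (P : probability T R) (Y : T -> int -> int) : Prop :=
  (forall n k, measurable [set w | Y w n = k]) /\
  forall (L : nat) (a : nat -> int) (m : int),
    P [set w | forall k, (k < L)%N -> Y w (m + k%:Z) = a k] =
    P [set w | forall k, (k < L)%N -> Y w k%:Z = a k].

Definition record_representable {R : realType} {d : measure_display}
  {T : measurableType d} (P : probability T R) (X : T -> Ostr) : Prop :=
  exists (d' : measure_display) (T' : measurableType d')
         (P' : probability T' R) (Y : T' -> int -> int),
    [/\ stationary P' Y,
        (forall w n, -1 <= Y w n) &
        same_law P X P' (fun w => rec_tree (Y w) : Ostr)].

(* Main.v *)
From HB Require Import structures.
From Stdlib Require Import Relations.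
From mathcomp Require Import finmap all_boot all_order all_algebra zify.
From mathcomp Require Import all_classical all_reals all_analysis measurable_realfun.
Require Import Defs.
Set Implicit Arguments. Unset Strict Implicit. Unset Printing Implicit Defensive.
Import Order.TTheory GRing.Theory Num.Theory.
Local Open Scope classical_set_scope.
Local Open Scope ring_scope.

(** The order [prec] is the depth-first (post-)order, a strict total order in
    which the descendants of a vertex form an interval ending at that vertex.
    A unique succession line without least vertex enumerates the vertices
    increasingly as [(u_n)], n in Z, and [Y_n] is the number of children of
    [u_(n+1)] minus one.  A vertex strictly between [u_i] and its parent has all
    its children strictly between them too, so the partial sums of [Y] from [i]
    are negative until the parent is reached: the record map is the parent map.  By mass transport, an infinite tree a.s. has no least vertex,
    and moving the root [m] steps along the line preserves the law, whence
    stationarity.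

    In class I/I, call a vertex deep if it has descendants in every generation.
    A deep vertex has a deep child (local finiteness) and on average exactly
    one, hence exactly one, so every foil contains at most one deep vertex;
    sending mass from each vertex to the deep vertex of its infinite foil shows
    that there are none.  All sets of descendants are then finite, so are the
    intervals of [prec], and the succession line is unique. *)

(** * The depth-first order on the vertices of one tree *)

(** [rls] without the minimality of the two exponents, which [rlsE] shows to be automatic on
    vertices. Without that clause, concatenating and cutting paths of ancestors is plain arithmetic
    of exponents. *)
Definition prec (s : ostr) (u v : int) : Prop :=
  anc s u v \/ exists m n, iter m.+1 (par s) u = iter n.+1 (par s) v /\
                           olt s (iter m (par s) u) (iter n (par s) v).

Section OrderedEFT.
Context (s : ostr) (Hs : is_oEFT s).
Local Notation F := (par s).
Local Notation V := (vert s).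

Lemma eft_root : V (root s). Proof. by case: Hs => -[]. Qed.

Lemma eft_par v : V v -> V (F v).
Proof. by case: Hs => -[_ + _ _ _] _; apply. Qed.

Lemma eft_iter k v : V v -> V (iter k F v).
Proof. by move=> Vv; elim: k => //= k; exact: eft_par. Qed.

Lemma eft_acyclic k v : V v -> (0 < k)%N -> iter k F v <> v.
Proof. by case: Hs => -[_ _ + _ _] _; apply. Qed.

Lemma eft_connected u v : V u -> V v -> exists m n, iter m F u = iter n F v.
Proof. by case: Hs => -[_ _ _ + _] _; apply. Qed.

Lemma eft_finite_children v : V v -> finite_set [set u | V u /\ F u = v].
Proof. by case: Hs => -[_ _ _ _ +] _; apply. Qed.

Lemma olt_irr u : V u -> ~~ olt s u u.
Proof. by move=> Vu; case: Hs => _ /(_ (F u)) /= [+ _ _]; apply. Qed.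

Lemma olt_trans u w x : V u -> V w -> V x -> F u = F w -> F w = F x ->
  olt s u w -> olt s w x -> olt s u x.
Proof.
move=> Vu Vw Vx uw wx; case: Hs => _ /(_ (F x)) /= [_ + _]; apply => //.
by split=> //; rewrite uw.
Qed.

Lemma olt_total u w : V u -> V w -> F u = F w -> u <> w -> olt s u w \/ olt s w u.
Proof. by move=> Vu Vw uw; case: Hs => _ /(_ (F w)) /= [_ _]; apply. Qed.

Lemma iter_par_inj m n u : V u -> iter m F u = iter n F u -> m = n.
Proof.
wlog mn : m n / (m <= n)%N => [H|] Vu E.
  by case: (leqP m n) => [|/ltnW] h; [exact: H|symmetry; exact: H].
apply/eqP; rewrite eqn_leq mn /= -subn_eq0; case: posnP => //= d0.
by case: (@eft_acyclic _ (iter m F u) (eft_iter m Vu) d0); rewrite -iterD subnK.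
Qed.

(** All comparisons take place on the path of ancestors of [v]. If [w] is an ancestor of [v], it
    lies either below the point where [u] and [v] meet, and [u] branches off before it, or at or
    above that point, and is an ancestor of [u]. *)
Lemma prec_trans u v w : V u -> V v -> V w -> prec s u v -> prec s v w -> prec s u w.
Proof.
move=> Vu Vv Vw [[k [k0 vE]]|[m [n [E L]]]] [[l [l0 wE]]|[p [q [E' L']]]].
- left; exists (l + k)%N; split; first lia.
  by rewrite iterD -vE.
- right; exists (p + k)%N, q; split; last by rewrite iterD -vE.
  by rewrite -E' -addSn iterD -vE.
- case: (leqP l n) => ln.
    right; exists m, (n - l)%N; rewrite wE -!iterD addSn subnK; last lia.
    by rewrite E.
  left; exists (l - n.+1 + m.+1)%N; split; first lia.
  by rewrite iterD E -iterD subnK.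
(* Of the two meeting points on the path above [v], the higher one decides; at equal heights three
   siblings are compared. *)
- right; case: (ltngtP n p) => np.
  + have e : iter p F v = iter (p - n.+1 + m.+1)%N F u.
      by rewrite iterD E -iterD subnK.
    exists (p - n.+1 + m.+1)%N, q; split; last by rewrite -e.
    by rewrite /= -e.
  + have e : iter n F v = iter (n - p.+1 + q.+1)%N F w.
      by rewrite iterD -E' -iterD subnK.
    exists m, (n - p.+1 + q.+1)%N; split; last by rewrite -e.
    by rewrite [RHS]/= -e.
  + subst p; exists m, q; split; first by rewrite E.
    by apply: (olt_trans _ _ _ _ _ L L') => //; exact: eft_iter.
Qed.

Lemma prec_irr u : V u -> ~ prec s u u.
Proof.
move=> Vu [[k [k0 E]]|[m [n [/(iter_par_inj Vu)[<-]]]]].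
  exact: (eft_acyclic Vu k0 (esym E)).
by apply/negP/olt_irr/eft_iter.
Qed.

Lemma prec_asym u v : V u -> V v -> prec s u v -> ~ prec s v u.
Proof. by move=> Vu Vv uv vu; exact: (prec_irr Vu (prec_trans Vu Vv Vu uv vu)). Qed.

(** Descend from a common ancestor along both paths until they part; there two distinct siblings are
    comparable. *)
Lemma prec_total u v : V u -> V v -> u = v \/ prec s u v \/ prec s v u.
Proof.
move=> Vu Vv; have [m [n]] := eft_connected Vu Vv.
elim: m n => [|m IH] [|n] E.
- by left.
- by right; right; left; exists n.+1.
- by right; left; left; exists m.+1.
- case: (pselect (iter m F u = iter n F v)) => [/IH//|ne]; right.
  have [L|L] := olt_total (eft_iter m Vu) (eft_iter n Vv) E ne.
  + by left; right; exists m, n.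
  + by right; right; exists n, m.
Qed.

Lemma prec_par v : prec s v (F v).
Proof. by left; exists 1%N. Qed.

(** A vertex that branches off to the left of [w] also precedes every descendant of [w]. Hence the
    descendants of [w] form an interval ending at [w]. *)
Lemma prec_convex v x w : V v -> V x -> V w ->
  anc s v w -> prec s v x -> prec s x w -> anc s x w.
Proof.
move=> Vv Vx Vw [k [_ wE]] vx [//|[m [n [E L]]]]; exfalso.
apply: (prec_asym Vv Vx vx); right; exists m, (n + k)%N.
by rewrite iterD -wE -addSn iterD -wE.
Qed.

Lemma prec_siblings u w : V u -> V w -> F u = F w -> prec s u w -> olt s u w.
Proof.
move=> Vu Vw E uw; have [//|wu] : olt s u w \/ olt s w u.
  by apply: olt_total => // e; apply: (@prec_irr u) => //; rewrite {2}e.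
by exfalso; apply: (prec_asym Vu Vw uw); right; exists 0%N, 0%N.
Qed.

Lemma olt_prec u w : F u = F w -> olt s u w -> prec s u w.
Proof. by move=> E L; right; exists 0%N, 0%N. Qed.

Lemma rlsE u v : V u -> V v -> rls s u v <-> prec s u v.
Proof.
move=> Vu Vv; split=> [] [|]; [by left| |by left|].
  by move=> [[|m] [[|n] []]]// _ _ E _ L; right; exists m, n.
move=> [m [n [E L]]]; right; exists m.+1, n.+1; split=> // m' n' m'0 n'0 E'.
(* By acyclicity the difference of the two exponents is the same for all common ancestors, so
   bounding one exponent bounds the other. *)
have eq1 : (m' + n.+1 = m.+1 + n')%N.
  apply: (iter_par_inj Vu); rewrite addnC iterD E' -iterD addnC iterD -E.
  by rewrite -iterD addnC.
suff : ~ (m' <= m)%N by lia.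
move=> lt; have/negP[] := olt_irr (eft_iter m Vu).
suff {2}-> : iter m F u = iter n F v by [].
have -> : n = (m - m' + n')%N by lia.
by rewrite iterD -E' -iterD subnK.
Qed.

End OrderedEFT.

(** * Successors in the depth-first order and succession lines *)

Definition least (s : ostr) (u : int) : Prop :=
  vert s u /\ forall v, vert s v -> v = u \/ prec s u v.

Definition nxt (s : ostr) (u v : int) : Prop :=
  [/\ vert s u, vert s v, prec s u v &
      forall w, vert s w -> prec s u w -> w = v \/ prec s v w].

Fixpoint chain (s : ostr) (n : nat) (u v : int) : Prop :=
  if n is n'.+1 then exists w, nxt s u w /\ chain s n' w v else u = v.

(** Displacement by [m] along the line; [Negz n] is -(n+1), hence [n.+1] steps. As a relation,
    unlike iterates of [afun] and [bfun], it fails where the line ends, and its measurability is a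
    matter of countable quantifiers. *)
Definition shift (s : ostr) (m : int) (u v : int) : Prop :=
  match m with Posz n => chain s n u v | Negz n => chain s n.+1 v u end.

(** The witness is a finite list because lists of integers are countable, which makes this a
    measurable condition on [s]. *)
Definition nchild (s : ostr) (v c : int) : Prop :=
  exists l : seq int, [/\ uniq l, (size l)%:Z = c &
    forall u, u \in l <-> vert s u /\ par s u = v].

Definition order_iso (s : ostr) (f : int -> int) : Prop :=
  [/\ forall n, vert s (f n), forall v, vert s v -> exists n, f n = v &
      forall i j, i < j -> prec s (f i) (f j)].

Section Successors.
Context (s : ostr) (Hs : is_oEFT s).
Local Notation F := (par s).
Local Notation V := (vert s).

Lemma nxt_unique u v w : nxt s u v -> nxt s u w -> v = w.
Proof.
move=> [_ Vv uv mv] [_ Vw uw mw].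
have [//|vw] := mw _ Vv uv; have [//|wv] := mv _ Vw uw.
by case: (prec_asym Hs Vv Vw wv).
Qed.

(** By totality, minimality of [v] above [u] is also maximality of [u] below [v]; this makes [is_a]
    and [is_b] two readings of one covering relation. *)
Lemma nxt_lower u v w : nxt s u v -> V w -> prec s w v -> w = u \/ prec s w u.
Proof.
move=> [Vu Vv uv mv] Vw wv; have [->|[|uw]] := prec_total Hs Vw Vu; [by left|by right|].
have [e|vw] := mv _ Vw uw; first by move: wv; rewrite e => /(prec_irr Hs Vv).
by case: (prec_asym Hs Vw Vv wv).
Qed.

Lemma nxt_inj u v w : nxt s u w -> nxt s v w -> u = v.
Proof.
move=> uw vw; have [Vu _ uw' _] := uw; have [Vv _ vw' _] := vw.
have [//|vu] := nxt_lower vw Vu uw'; have [//|uv] := nxt_lower uw Vv vw'.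
by case: (prec_asym Hs Vu Vv vu).
Qed.

Lemma is_aE u v : V u -> is_a s u v <-> nxt s u v.
Proof.
move=> Vu; split.
  move=> [Vv uv mv]; split=> //; first exact/(rlsE Hs).
  move=> w Vw /(rlsE Hs Vu Vw) /(mv _ Vw)[->|/(rlsE Hs Vv Vw)]; by [left|right].
move=> [_ Vv uv mv]; split=> //; first exact/(rlsE Hs).
move=> w Vw /(rlsE Hs Vu Vw) /(mv _ Vw)[->|/(rlsE Hs Vv Vw)]; by [left|right].
Qed.

Lemma is_bE u v : V v -> is_b s v u <-> nxt s u v.
Proof.
move=> Vv; split.
  move=> [Vu /(rlsE Hs Vu Vv) uv mu]; split=> // w Vw uw.
  have [->|[wv|]] := prec_total Hs Vw Vv; [by left| |by right].
  have [e|/(rlsE Hs Vw Vu) wu] := mu _ Vw (proj2 (rlsE Hs Vw Vv) wv).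
    by move: uw; rewrite e => /(prec_irr Hs Vu).
  by case: (prec_asym Hs Vu Vw uw).
move=> uv; have [Vu _ uv' _] := uv; split=> //; first exact/(rlsE Hs).
move=> w Vw /(rlsE Hs Vw Vv) /(nxt_lower uv Vw)[->|h]; [by left|].
by right; exact/(rlsE Hs).
Qed.

Lemma afunP u : V u -> nxt s u (afun s u) \/ afun s u = u /\ forall v, ~ nxt s u v.
Proof.
move=> Vu; rewrite /afun; case: xgetP => [v _ /(is_aE _ Vu)|nv]; first by left.
by right; split=> // v /(is_aE _ Vu); exact: nv.
Qed.

Lemma bfunP v : V v -> nxt s (bfun s v) v \/ bfun s v = v /\ forall u, ~ nxt s u v.
Proof.
move=> Vv; rewrite /bfun; case: xgetP => [u _ /(is_bE _ Vv)|nu]; first by left.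
by right; split=> // u /(is_bE _ Vv); exact: nu.
Qed.

Lemma afunE u v : nxt s u v -> afun s u = v.
Proof.
move=> uv; have [Vu _ _ _] := uv.
by case: (afunP Vu) => [/nxt_unique/(_ uv)//|[_ /(_ v)]].
Qed.

Lemma bfunE u v : nxt s u v -> bfun s v = u.
Proof.
move=> uv; have [_ Vv _ _] := uv.
by case: (bfunP Vv) => [/nxt_inj/(_ uv)//|[_ /(_ u)]].
Qed.

Lemma vert_iter_afun n u : V u -> V (iter n (afun s) u).
Proof.
move=> Vu; elim: n => //= n IH.
by case: (afunP IH) => [[]//|[->]].
Qed.

Lemma vert_iter_bfun n u : V u -> V (iter n (bfun s) u).
Proof.
move=> Vu; elim: n => //= n IH.
by case: (bfunP IH) => [[]//|[->]].
Qed.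

Lemma le_iter_afun n u : V u -> iter n (afun s) u = u \/ prec s u (iter n (afun s) u).
Proof.
move=> Vu; elim: n => [|n IH] /=; first by left.
have Vn := vert_iter_afun n Vu.
case: (afunP Vn) => [[_ Vn1 h _]|[-> _]//]; right.
by case: IH => [E|p]; [rewrite -{1}E|exact: (prec_trans Hs Vu Vn Vn1 p h)].
Qed.

Lemma ge_iter_bfun n u : V u -> iter n (bfun s) u = u \/ prec s (iter n (bfun s) u) u.
Proof.
move=> Vu; elim: n => [|n IH] /=; first by left.
have Vn := vert_iter_bfun n Vu.
case: (bfunP Vn) => [[Vn1 _ h _]|[-> _]//]; right.
by case: IH => [E|p]; [rewrite -{2}E|exact: (prec_trans Hs Vn1 Vn Vu h p)].
Qed.

Lemma sline_self u : sline s u u.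
Proof. by exists 0%N; left. Qed.

(** Without a predecessor, [bfun] is stuck at [v], so the line through [v] consists of [v] and later
    vertices. As it contains all vertices, [v] would be least. *)
Lemma usl_prev v : unique_succession_line s -> ~ least s v -> V v ->
  nxt s (bfun s v) v.
Proof.
move=> usl nl Vv; case: (bfunP Vv) => // -[bE _]; case: nl; split=> // u Vu.
have [n []->] : sline s v u by rewrite (usl _ _ Vv Vu); exact: sline_self.
  by left; elim: n => //= n ->.
exact: le_iter_afun.
Qed.

(** Without a successor, the line through [v] never gets past [v], yet it must contain the parent of
    [v], which comes later. *)
Lemma usl_next v : unique_succession_line s -> V v -> nxt s v (afun s v).
Proof.
move=> usl Vv; case: (afunP Vv) => // -[aE _]; exfalso.
have VF := eft_par Hs Vv; have vF := prec_par s v.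
have [n []E] : sline s v (F v) by rewrite (usl _ _ Vv VF); exact: sline_self.
  have := ge_iter_bfun n Vv; rewrite -E => -[e|].
    by move: vF; rewrite e => /(prec_irr Hs Vv).
  exact: (prec_asym Hs Vv VF vF).
have e : F v = v by rewrite E; elim: n {E} => //= n ->.
by move: vF; rewrite e => /(prec_irr Hs Vv).
Qed.

Lemma prec_increasing (f : int -> int) : (forall n, V (f n)) ->
  (forall n, prec s (f n) (f (n + 1))) -> forall i j, i < j -> prec s (f i) (f j).
Proof.
move=> Vf step i j ij.
have -> : j = i + (`|j - i|%N.-1.+1)%:Z by lia.
elim: (_.-1) => [|n IH]; first exact: step.
have -> : i + n.+2%:Z = i + n.+1%:Z + 1 by lia.
exact: (prec_trans Hs (Vf _) (Vf _) (Vf _) IH (step _)).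
Qed.

Lemma usl_order_iso : unique_succession_line s -> (forall u, ~ least s u) ->
  exists f, order_iso s f /\ f 0 = root s.
Proof.
move=> usl nl; have Vr := eft_root Hs.
pose f n := match n with Posz n => iter n (afun s) (root s)
                       | Negz n => iter n.+1 (bfun s) (root s) end.
have Vf n : V (f n).
  by case: n => n; [exact: vert_iter_afun|exact: vert_iter_bfun].
exists f; split=> //; split=> //.
  move=> v Vv; have [n []->] : sline s (root s) v.
  - by rewrite (usl _ _ Vr Vv); exact: sline_self.
  - by case: n => [|n]; [exists 0|exists (Negz n)].
  - by exists n%:Z.
apply: prec_increasing => // -[n|[|n]].
- have -> : (n%:Z + 1)%R = n.+1%:Z by lia.
  by have [] := usl_next usl (Vf n%:Z).
- by have [] := usl_prev usl (nl _) Vr.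
- have -> : (Negz n.+1 + 1)%R = Negz n by lia.
  by have [] := usl_prev usl (nl _) (Vf (Negz n)).
Qed.

Lemma chain_afun n u v : chain s n u v -> v = iter n (afun s) u.
Proof. by elim: n u => //= n IH u [w [/afunE<- /IH ->]]; rewrite -iterSr. Qed.

Lemma chain_bfun n u v : chain s n u v -> u = iter n (bfun s) v.
Proof. by elim: n u => //= n IH u [w [/bfunE<- /IH ->]]. Qed.

Lemma exists_min_prec (l : seq int) (Q : int -> Prop) :
  (forall x, Q x -> V x) -> (exists2 x, x \in l & Q x) ->
  exists2 x, Q x & forall z, z \in l -> Q z -> z = x \/ prec s x z.
Proof.
move=> QV; elim: l => [[]//|a l IH] [x xl Qx].
have [/IH[m Qm mm]|no] := pselect (exists2 x, x \in l & Q x).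
  have [Qa|nQa] := pselect (Q a); last first.
    exists m => // z; rewrite inE => /orP[/eqP->//|]; exact: mm.
  have [e|[am|ma]] := prec_total Hs (QV _ Qa) (QV _ Qm).
  - exists m => // z; rewrite inE => /orP[/eqP->|]; [by left|exact: mm].
  - exists a => // z; rewrite inE => /orP[/eqP->|zl Qz]; first by left.
    have [->|mz] := mm _ zl Qz; right=> //.
    exact: (prec_trans Hs (QV _ Qa) (QV _ Qm) (QV _ Qz) am).
  - by exists m => // z; rewrite inE => /orP[/eqP->|]; [right|exact: mm].
exists a.
  by move: xl; rewrite inE => /orP[/eqP<-//|xl]; case: no; exists x.
by move=> z; rewrite inE => /orP[/eqP->|zl Qz]; [left|case: no; exists z].
Qed.

(** The minimum of the vertices after [u] and up to [v] covers [u]. Removing it from the list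
    bounding this interval leaves a shorter list for the rest. *)
Lemma finite_interval_chain (l : seq int) u v : V u -> V v -> prec s u v ->
  (forall x, V x -> prec s u x -> x = v \/ prec s x v -> x \in l) ->
  exists n, chain s n u v.
Proof.
have [N lN] := ubnP (size l).
elim: N => // N IH in l u lN * => Vu Vv uv lP.
pose Q x := [/\ V x, prec s u x & x = v \/ prec s x v].
have [||w [Vw uw wv] mw] := @exists_min_prec l Q.
  by move=> x [].
  by exists v; [apply: lP => //; left|split=> //; left].
have wl := lP w Vw uw wv.
have un : nxt s u w.
  split=> // x Vx ux; have [e|[xv|vx]] := prec_total Hs Vx Vv.
  - by apply: mw; [apply: lP|split] => //; left.
  - by apply: mw; [apply: lP|split] => //; right.
  - case: wv => [->|wv]; first by right.
    by right; exact: (prec_trans Hs Vw Vv Vx wv vx).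
case: wv => [wv|wv]; first by exists 1%N; exists v; rewrite -wv.
have [|||||n wvn] := IH (rem w l) w => //.
- by rewrite size_rem//; case: (l) wl lN.
- move=> x Vx wx xv; have : x \in l.
    by apply: lP => //; exact: (prec_trans Hs Vu Vw Vx uw wx).
  rewrite (perm_mem (perm_to_rem wl)) inE => /orP[/eqP e|//].
  by move: wx; rewrite e => /(prec_irr Hs Vw).
by exists n.+1, w.
Qed.

Lemma finite_descendants_usl :
  (forall v, V v -> finite_set [set u | V u /\ anc s u v]) ->
  unique_succession_line s.
Proof.
move=> fin.
have reach u v : V u -> V v -> prec s u v -> exists n, chain s n u v.
  move=> Vu Vv uv; have [m [n E]] := eft_connected Hs Vu Vv.
  (* One generation above a common ancestor, so that [u] and [v] are strict descendants of [w] even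
     if one is an ancestor of the other. By convexity the interval between them consists of
     descendants of [w]. *)
  pose w := iter m.+1 F u.
  have uw : anc s u w by exists m.+1.
  have vw : anc s v w by exists n.+1; rewrite /w /= E.
  have Vw : V w by exact: eft_iter.
  have /finite_seqP[l lE] := fin w Vw.
  apply: (@finite_interval_chain l) => // x Vx ux xv.
  suff : [set` l] x by [].
  rewrite -lE; split=> //; case: xv => [->//|xv].
  by apply: (prec_convex Hs Vu Vx Vw) => //; apply: (prec_trans Hs Vx Vv) => //; left.
have slineE o : V o -> sline s o = [set v | V v].
  move=> Vo; apply/seteqP; split=> v /=.
    by move=> [n []->]; [exact: vert_iter_bfun|exact: vert_iter_afun].
  move=> Vv; have [<-|[/(reach _ _ Vo Vv)|/(reach _ _ Vv Vo)]] := prec_total Hs Vo Vv.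
  - exact: sline_self.
  - by move=> [n /chain_afun->]; exists n; right.
  - by move=> [n /chain_bfun->]; exists n; left.
by move=> o o' Vo Vo'; rewrite !slineE.
Qed.

End Successors.

(** * The offspring sequence along the line and its record graph *)

(* [offspring s n + 1] counts the children of [u_(n+1)], where [u_0] is the root
   and [u_(n+1)] is the successor of [u_n]. *)
Definition offspring (s : ostr) (n : int) : int :=
  xget 0 [set k | exists v, shift s (n + 1) (root s) v /\ nchild s v (k + 1)].

Section RecordCoding.
Context (s : ostr) (Hs : is_oEFT s) (f : int -> int) (Hf : order_iso s f).
Local Notation F := (par s).
Local Notation V := (vert s).

Let Vf n : V (f n). Proof. by case: Hf. Qed.
Let fsurj v : V v -> exists n, f n = v. Proof. by case: Hf => _ + _; apply. Qed.
Let fmono i j : i < j -> prec s (f i) (f j). Proof. by case: Hf => _ _; apply. Qed.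

Lemma order_iso_inj : injective f.
Proof.
move=> i j E; case: (ltgtP i j) => // /fmono; rewrite E => /(prec_irr Hs) [] //.
Qed.

Lemma order_iso_lt i j : prec s (f i) (f j) <-> i < j.
Proof.
split=> [p|/fmono//]; case: (ltgtP i j) => // [ji|e].
  by case: (prec_asym Hs (Vf i) (Vf j) p (fmono ji)).
by move: p; rewrite e => /(prec_irr Hs) [].
Qed.

Lemma order_iso_nxt i v : nxt s (f i) v <-> v = f (i + 1).
Proof.
have nx : nxt s (f i) (f (i + 1)).
  split=> //; first by apply: fmono; lia.
  move=> w /fsurj[j <-] /order_iso_lt ij.
  have [->|] : j = i + 1 \/ i + 1 < j by lia.
    by left.
  by move/fmono; right.
by split=> [/(nxt_unique Hs nx)|->].
Qed.

Lemma order_iso_chain n i v : chain s n (f i) v <-> v = f (i + n%:Z).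
Proof.
elim: n i v => [|n IH] i v /=; first by rewrite addr0; split.
split=> [[w [/order_iso_nxt -> /IH ->]]|->].
  by congr f; lia.
exists (f (i + 1)); split; first exact/order_iso_nxt.
by apply/IH; congr f; lia.
Qed.

Lemma order_iso_shift m i v : V v -> shift s m (f i) v <-> v = f (i + m).
Proof.
case: m => n Vv; first exact: order_iso_chain.
have [j <-] := fsurj Vv; rewrite /shift order_iso_chain.
by split=> [/order_iso_inj->|/order_iso_inj->]; congr f; lia.
Qed.

Lemma shift_vert m u v : V u -> shift s m u v -> V v.
Proof.
case: m => n Vu /=; last by move=> [w [[]]].
elim: n u Vu => [|n IH] u Vu /=; first by move=> <-.
by move=> [w [[_ Vw _ _] /IH]]; apply.
Qed.

Lemma nchild_exists v : V v -> exists l : seq int,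
  uniq l /\ forall u, u \in l <-> V u /\ F u = v.
Proof.
move=> /(eft_finite_children Hs)/finite_seqP[l lE].
exists (undup l); split; first exact: undup_uniq.
move=> u; rewrite mem_undup.
by have := congr1 (fun A : set int => A u) lE => /= ->.
Qed.

Lemma nchild_unique v c c' : nchild s v c -> nchild s v c' -> c = c'.
Proof.
move=> [l [ul <- lP]] [l' [ul' <- l'P]]; congr Posz.
apply/perm_size/uniq_perm => // u.
by apply/idP/idP => [/lP/l'P|/l'P/lP].
Qed.

Context (f0 : f 0 = root s).

(** The default value of [xget] is never taken: the displaced vertex exists and has finitely many
    children. *)
Lemma offspringP n k : offspring s n = k <-> nchild s (f (n + 1)) (k + 1).
Proof.
have [l [ul lP]] := nchild_exists (Vf (n + 1)).
have nl : nchild s (f (n + 1)) (size l)%:Z by exists l.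
pose A := [set k | exists v, shift s (n + 1) (root s) v /\ nchild s v (k + 1)].
have AE k' : A k' <-> nchild s (f (n + 1)) (k' + 1).
  split=> [[v [sv nc]]|nc].
    have Vv : V v by apply: shift_vert sv; rewrite -f0.
    by move: sv nc; rewrite -f0 => /(order_iso_shift _ _ Vv) ->; rewrite add0r.
  exists (f (n + 1)); split=> //.
  by rewrite -f0; apply/order_iso_shift => //; rewrite add0r.
have /AE Ay : A (offspring s n).
  by apply: xgetPex; exists ((size l)%:Z - 1); apply/AE; rewrite subrK.
by split=> [<-//|nc]; have := nchild_unique Ay nc; lia.
Qed.

Lemma offspring_ge n : -1 <= offspring s n.
Proof.
have [l [_ /eqP + _]] := proj1 (offspringP n _) (erefl (offspring s n)).
lia.
Qed.

(* The children lists of [u_(i+1), ..., u_(i+N)] are pairwise disjoint. *)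
Lemma sum_offspring i N : exists l : seq int,
  [/\ uniq l, (size l)%:Z = \sum_(0 <= k < N) offspring s (i + k%:Z) + N%:Z &
  forall u, u \in l <-> V u /\ exists2 k, (k < N)%N & F u = f (i + k%:Z + 1)].
Proof.
elim: N => [|N [l [ul lE lP]]].
  exists [::]; split=> //; first by rewrite big_nil.
  by move=> u; split=> // -[_ []].
have [l' [ul' l'E l'P]] := proj1 (offspringP (i + N%:Z) _) (erefl _).
exists (l ++ l'); split.
- rewrite cat_uniq ul ul' andbT /=; apply/hasPn => u /l'P[_ E].
  apply/negP => /lP[_ [k kN]]; rewrite E => /order_iso_inj; lia.
- by rewrite size_cat PoszD lE l'E big_nat_recr//= -(addn1 N) PoszD !addrA; congr (_ + _); rewrite addrAC.
- move=> u; rewrite mem_cat; split.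
    move=> /orP[/lP[Vu [k kN E]]|/l'P[Vu E]]; split=> //.
      by exists k => //; lia.
    by exists N.
  move=> [Vu [k kN E]]; apply/orP; have [e|lt] : k = N \/ (k < N)%N by lia.
    by right; apply/l'P; rewrite E e.
  by left; apply/lP; split=> //; exists k.
Qed.

(** [psum] from [i] to [n] is the number of children of [u_(i+1)], ..., [u_n] minus n - i, so both
    claims count these children. *)
Lemma psum_offspring_par i j : F (f i) = f j ->
  (forall n, i < n -> n < j -> psum (offspring s) i n < 0) /\
  0 <= psum (offspring s) i j.
Proof.
move=> Fi; have ij : i < j by apply/order_iso_lt; rewrite -Fi; exact: prec_par.
split=> [n ni nj|]; rewrite /psum.
  have [l [ul lE lP]] := sum_offspring i `|n - i|.
  (* All these children are among [u_(i+1)], ..., [u_(n-1)], one too few for a nonnegative sum. *)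
  suff : (size l <= `|n - i|.-1)%N by move: lE; lia.
  rewrite -[leqRHS](size_iota 1) -(size_map (fun k : nat => f (i + k%:Z))).
  apply: uniq_leq_size => // u /lP[/fsurj[a <-] [k kN E]].
  have ak : a < i + k%:Z + 1 by apply/order_iso_lt; rewrite -E; exact: prec_par.
  suff ia : i < a.
    apply/mapP; exists `|a - i|%N; last by congr f; lia.
    rewrite mem_iota; lia.
  have [ai|//] : a <= i \/ i < a by lia.
  exfalso; have jk : j <= i + k%:Z + 1; last by lia.
  (* otherwise [u_i] would be a strict descendant of a vertex before its parent *)
  have [e|lt] : a = i \/ a < i by lia.
    by move: E; rewrite e Fi => /order_iso_inj; lia.
  have [q [q0]] : anc s (f i) (f (i + k%:Z + 1)).
    apply: (@prec_convex _ Hs (f a)) => //; try by [exact: fmono].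
    - by exists 1%N; split=> //=; rewrite E.
    - by apply: fmono; lia.
  rewrite -(prednK q0) iterSr Fi; case: (q.-1) => [|q'] /= Eq.
    by move/order_iso_inj: Eq; lia.
  apply/ltW/order_iso_lt; rewrite Eq; left; exists q'.+1; by [].
have [l [ul lE lP]] := sum_offspring i `|j - i|.
(* Conversely [u_i], ..., [u_(j-1)] all have their parents among [u_(i+1)], ..., [u_j]. *)
suff : (`|j - i| <= size l)%N by move: lE; lia.
rewrite -[leqLHS](size_iota 0) -(size_map (fun k : nat => f (i + k%:Z))).
apply: uniq_leq_size.
  by rewrite map_inj_uniq ?iota_uniq// => a b /order_iso_inj; lia.
move=> u /mapP[k]; rewrite mem_iota => kN ->; apply/lP; split=> //.
have [c Ec] := fsurj (eft_par Hs (Vf (i + k%:Z))).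
have kc : i + k%:Z < c by apply/order_iso_lt; rewrite Ec; exact: prec_par.
suff cj : c <= j by exists `|(c - i - 1)%R|%N; [lia|rewrite -Ec; congr f; lia].
have [e|k0] : k = 0%N \/ (0 < k)%N by lia.
  by move: Ec; rewrite e addr0 Fi => /order_iso_inj ->.
(* By convexity [u_(i+k)], lying between [u_j] and its child [u_i], descends from [u_j]; its parent
   [u_c] is then [u_j] or a descendant of it. *)
have [q [q0]] : anc s (f (i + k%:Z)) (f j).
  apply: (@prec_convex _ Hs (f i)) => //.
  - by exists 1%N; split=> //=; rewrite Fi.
  - by apply: fmono; lia.
  - by apply: fmono; lia.
rewrite -(prednK q0) iterSr -Ec; case: (q.-1) => [|q'] Eq.
  by move/order_iso_inj: Eq => <-.
by apply/ltW/order_iso_lt; rewrite Eq; left; exists q'.+1.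
Qed.

Lemma rec_next_par i j : F (f i) = f j -> rec_next (offspring s) i = j.
Proof.
move=> Fi; have [lt ge] := psum_offspring_par Fi.
have ij : i < j by apply/order_iso_lt; rewrite -Fi; exact: prec_par.
have cand m : rec_cand (offspring s) i m -> j <= m.
  by move=> [im p]; rewrite leNgt; apply/negP => /(lt _ im); rewrite ltNge p.
apply: xget_unique => [|m [cm mm]]; first by split.
apply/eqP; rewrite eq_le cand// andbT; exact: mm.
Qed.

(** A path of ancestors is a path of record edges, so a common ancestor of [u_0] and [u_i] connects
    0 with [i]. *)
Lemma rec_tree_connected i : vert (rec_tree (offspring s)) i.
Proof.
apply/asboolP => /=.
have to_anc k a b : iter k F (f a) = f b ->
    clos_refl_sym_trans int (rec_edge (offspring s)) a b.
  elim: k a => [|k IH] a; first by move=> /order_iso_inj ->; exact: rst_refl.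
  have [c Ec] := fsurj (eft_par Hs (Vf a)).
  rewrite iterSr -Ec => /IH; apply: rst_trans; apply: rst_step.
  rewrite /rec_edge (rec_next_par (esym Ec)); split=> // e.
  have : a < c by apply/order_iso_lt; rewrite Ec; exact: prec_par.
  by rewrite e ltxx.
have [m [n E]] := eft_connected Hs (Vf 0) (Vf i).
have [c Ec] := fsurj (eft_iter Hs m (Vf 0)).
apply: (rst_trans _ _ _ c); first by apply: (to_anc m).
by apply/rst_sym/(to_anc n); rewrite -E.
Qed.

Lemma rec_tree_riso : riso (rec_tree (offspring s)) s f.
Proof.
split=> //; split=> //.
- by move=> v w _ _; exact: order_iso_inj.
- by move=> w /fsurj[n <-]; exists n => //; exact: rec_tree_connected.
- move=> v _; have [c Ec] := fsurj (eft_par Hs (Vf v)).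
  by rewrite -Ec; congr f; exact: rec_next_par.
- move=> u w _ _ /=; have [c Ec] := fsurj (eft_par Hs (Vf u)).
  have [c' Ec'] := fsurj (eft_par Hs (Vf w)).
  rewrite [par _ u](rec_next_par (esym Ec)) [par _ w](rec_next_par (esym Ec')) => e.
  have E : F (f u) = F (f w) by rewrite -Ec -Ec' e.
  apply/idP/idP => [/fmono/(prec_siblings Hs)|/(olt_prec E)/order_iso_lt//].
  exact.
Qed.

End RecordCoding.

(** The inverse is meaningful on vertices only, with default 0 elsewhere. The assumptions on [s1]
    are closure properties rather than [is_oEFT], so that [rec_tree] is covered. *)
Lemma riso_sym (s1 s2 : ostr) phi : vert s1 (root s1) ->
  (forall v, vert s1 v -> vert s1 (par s1 v)) -> riso s1 s2 phi ->
  exists psi, riso s2 s1 psi /\ forall v, vert s1 v -> psi (phi v) = v.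
Proof.
move=> V1 P1 [phi0 [phiV phiI phiS phiP phiO]].
pose psi w := xget 0 [set v | vert s1 v /\ phi v = w].
have psiK v : vert s1 v -> psi (phi v) = v.
  move=> Vv; apply: xget_unique; first by split.
  by move=> u [Vu /phiI]; apply.
exists psi; split=> //; split; first by rewrite -phi0 psiK.
split.
- by move=> w /phiS[v Vv <-]; rewrite psiK.
- by move=> w w' /phiS[v Vv <-] /phiS[v' Vv' <-]; rewrite !psiK// => ->.
- by move=> v Vv; exists (phi v); [exact: phiV|exact: psiK].
- by move=> w /phiS[v Vv <-]; rewrite -phiP// !psiK//; exact: P1.
- move=> u w /phiS[v Vv <-] /phiS[v' Vv' <-].
  rewrite !psiK// -!phiP// => /phiI E; rewrite phiO//; apply: E; exact: P1.
Qed.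

(** * Measurability of events built by countable connectives from the coordinates *)

Section CountableConnectives.
Context d (T : measurableType d).
Implicit Types P Q : T -> Prop.

Lemma measurable_and P Q : measurable [set w | P w] -> measurable [set w | Q w] ->
  measurable [set w | P w /\ Q w].
Proof. exact: measurableI. Qed.

Lemma measurable_or P Q : measurable [set w | P w] -> measurable [set w | Q w] ->
  measurable [set w | P w \/ Q w].
Proof. exact: measurableU. Qed.

Lemma measurable_not P : measurable [set w | P w] -> measurable [set w | ~ P w].
Proof. exact: measurableC. Qed.

Lemma measurable_imply P Q : measurable [set w | P w] -> measurable [set w | Q w] ->
  measurable [set w | P w -> Q w].
Proof.
move=> mP mQ; rewrite (_ : [set w | P w -> Q w] = [set w | ~ P w \/ Q w]).
  by apply: measurable_or => //; exact: measurable_not.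
by apply/funext => w; rewrite /mkset implyE.
Qed.

Lemma measurable_exists (I : countType) (P : I -> T -> Prop) :
  (forall i, measurable [set w | P i w]) -> measurable [set w | exists i, P i w].
Proof.
move=> mP; rewrite (_ : [set w | _] = \bigcup_n
    (if unpickle n is Some i then [set w | P i w] else set0)).
  by apply: bigcupT_measurable => n; case: unpickle.
apply/seteqP; split=> w /=.
  by move=> [i Pi]; exists (pickle i) => //; rewrite pickleK.
by move=> [n _]; case: unpickle => // i Pi; exists i.
Qed.

Lemma measurable_forall (I : countType) (P : I -> T -> Prop) :
  (forall i, measurable [set w | P i w]) -> measurable [set w | forall i, P i w].
Proof.
move=> mP; rewrite (_ : [set w | _] = [set w | ~ exists i, ~ P i w]).
  by apply/measurable_not/measurable_exists => i; exact: measurable_not.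
apply/seteqP; split=> w /=; first by move=> Pw [i]; apply; exact: Pw.
by move=> nex i; apply: contrapT => ni; apply: nex; exists i.
Qed.

Lemma measurable_prop (p : Prop) : measurable [set w : T | p].
Proof.
have [hp|hp] := pselect p.
  by rewrite (_ : [set _ | _] = setT)//; apply/seteqP; split.
by rewrite (_ : [set _ | _] = set0)//; apply/seteqP; split.
Qed.

End CountableConnectives.

Section Coordinates.

Lemma measurable_coord (A : set ostr) : coord_events A -> measurable (A : set Ostr).
Proof. exact: sub_sigma_algebra. Qed.

Lemma measurable_vert v : measurable [set s : Ostr | vert s v].
Proof. by apply: measurable_coord; left; exists v. Qed.

Lemma measurable_par u v : measurable [set s : Ostr | par s u = v].
Proof. by apply: measurable_coord; right; left; exists u, v. Qed.

Lemma measurable_olt u v : measurable [set s : Ostr | olt s u v].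
Proof. by apply: measurable_coord; right; right; left; exists u, v. Qed.

Lemma measurable_root v : measurable [set s : Ostr | root s = v].
Proof. by apply: measurable_coord; right; right; right; exists v. Qed.

(** Naming the intermediate vertex turns a composition into a countable union over labels; the same
    device serves below wherever a vertex depends on [s]. *)
Lemma measurable_iter n u v : measurable [set s : Ostr | iter n (par s) u = v].
Proof.
elim: n v => [|n IH] v /=; first exact: measurable_prop.
rewrite (_ : [set s : Ostr | _] =
  [set s : Ostr | exists w, iter n (par s) u = w /\ par s w = v]).
  apply: measurable_exists => w; apply: measurable_and; first exact: IH.
  exact: measurable_par.
by apply/seteqP; split=> s /=; [move=> E; eexists|move=> [w [-> ->]]].
Qed.

Lemma measurable_iter2 m n u v :
  measurable [set s : Ostr | iter m (par s) u = iter n (par s) v].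
Proof.
rewrite (_ : [set s : Ostr | _] =
  [set s : Ostr | exists w, iter m (par s) u = w /\ iter n (par s) v = w]).
  by apply: measurable_exists => w; apply: measurable_and; exact: measurable_iter.
by apply/seteqP; split=> s /=; [move=> E; eexists|move=> [w [-> ->]]].
Qed.

Lemma measurable_prec u v : measurable [set s : Ostr | prec s u v].
Proof.
apply: measurable_or.
  apply: measurable_exists => k; apply: measurable_and; first exact: measurable_prop.
  exact: (measurable_iter2 0).
apply: measurable_exists => i; apply: measurable_exists => i0.
apply: measurable_and; first exact: measurable_iter2.
rewrite (_ : [set s : Ostr | _] = [set s : Ostr | exists a b,
  iter i (par s) u = a /\ (iter i0 (par s) v = b /\ olt s a b)]).
  apply: measurable_exists => i1; apply: measurable_exists => i2.
  apply: measurable_and; first exact: measurable_iter.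
  by apply: measurable_and; [exact: measurable_iter|exact: measurable_olt].
apply/seteqP; split=> s /=; first by move=> L; do 2 eexists.
by move=> [a [b [-> [->]]]].
Qed.

End Coordinates.

(** * Cardinalities of sets of vertices as extended reals *)

Section Cardinal.
Local Open Scope ereal_scope.
Context (R : realType).

Definition num (A : set int) : \bar R := \esum_(u in A) 1.

Lemma num_ge0 A : 0 <= num A. Proof. exact: esum_ge0. Qed.

Lemma num0 : num set0 = 0. Proof. exact: esum_set0. Qed.

Lemma num1 x : num [set x] = 1. Proof. exact: esum_set1. Qed.

Lemma le_num A B : A `<=` B -> num A <= num B.
Proof.
move=> AB; rewrite /num -(setIidr AB) setIC esum_mkcondr esum_mkcond.
rewrite [leRHS]esum_mkcond; apply: le_esum => i _.
by case: ifP => // _; case: ifP.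
Qed.

Lemma num_fin A : num A \is a fin_num -> finite_set A.
Proof.
apply: contraPP => infA; suff -> : num A = +oo by [].
apply/eqyP => r r0; have [B BA Br] := infinite_set_fset (Num.truncn r).+1 infA.
apply: esum_ge; exists [set` B] => //.
apply: (@le_trans _ _ (Num.truncn r).+1%:R%:E).
  by rewrite lee_fin ltW// truncnS_gt.
move: Br; rewrite -(@ler_nat R) -lee_fin => /le_trans; apply.
by rewrite fsbig_finite//= card_fset_sum1 sumEFin natr_sum// set_fsetK.
Qed.

Lemma num_le1 A : (forall x y, A x -> A y -> x = y) -> num A <= 1.
Proof.
move=> sA; have [->|/set0P[x Ax]] := eqVneq A set0; first by rewrite num0.
by rewrite -(num1 x); apply: le_num => y /sA; exact.
Qed.

Lemma num_ge2 A x y : A x -> A y -> x <> y -> 1 + 1 <= num A.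
Proof.
move=> Ax Ay xy; apply: (@le_trans _ _ (num ([set x] `|` [set y]))); last first.
  by apply: le_num => z [->|->].
rewrite /num (esumID [set x])// (_ : _ `&` [set x] = [set x]).
  rewrite (_ : _ `&` _ = [set y]) ?esum_set1//.
  by apply/seteqP; split=> [z /= [[->|->]]|z ->] //=; split; [right|exact: nesym].
by apply/seteqP; split=> [z /= []//|z ->] /=; split; [left|].
Qed.

Lemma num_eq0 A : num A = 0 -> A = set0.
Proof.
apply: contraPP => /eqP/set0P[x Ax]; apply/eqP; rewrite gt_eqF//.
apply: (@lt_le_trans _ _ 1); first by rewrite lte_fin.
by rewrite -(num1 x); apply: le_num => y ->.
Qed.

Lemma measurable_num d (T : measurableType d) (Q : T -> int -> Prop) :
  (forall u, measurable [set w | Q w u]) ->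
  measurable_fun setT (fun w => num [set u | Q w u]).
Proof.
(* [g] enumerates the integers by naturals, which turns the sum over a set of labels into a series
   of indicator functions. *)
move=> mQ; pose g (n : nat) := if odd n then Negz n./2 else Posz n./2.
have gbij : set_bij [set: nat] [set: int] g.
  split=> //.
    move=> m n _ _ /=; rewrite /g -(odd_double_half m) -(odd_double_half n).
    by rewrite !halfD !oddD !odd_double !addbF !doubleK; case: (odd m) (odd n) => [] [] //=; lia.
  move=> [n|n] _.
    by exists n.*2 => //; rewrite /g odd_double doubleK.
  by exists n.*2.+1 => //; rewrite /g /= odd_double /= uphalf_double.
rewrite (_ : (fun w => _) =
    fun w => \sum_(i <oo) (\1_[set w | Q w (g i)] w)%:E).
  apply: (@ge0_emeasurable_sum _ _ _ _ _ xpredT) => n.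
    by move=> x _ _; rewrite lee_fin.
  by move=> _; apply/measurable_EFinP/measurable_indic; exact: mQ.
apply/funext => w; rewrite nneseries_esumT; last by move=> n; rewrite lee_fin.
rewrite /num esum_mkcond (@reindex_esum _ _ _ _ _ g _ gbij); apply: eq_esum => i _.
by rewrite indicE; have [h|h] := pselect (Q w (g i)); [rewrite !mem_set|rewrite !memNset].
Qed.

End Cardinal.

(** * The mass transport principle for invariant relations between vertices *)

(** The relations along which [u] may send unit mass to each [v] with [K s u v]. Invariance is asked
    in one direction; inverse isomorphisms give the other. A property of single vertices is a
    relation that ignores the sender. *)
Definition vertex_relation (K : ostr -> int -> int -> Prop) : Prop :=
  [/\ forall s x, K (reroot s x) = K s,
      forall u v, measurable [set s : Ostr | K s u v] &
      forall s1 s2 phi u v, is_oEFT s1 -> is_oEFT s2 -> riso s1 s2 phi ->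
        vert s1 u -> vert s1 v -> K s1 u v -> K s2 (phi u) (phi v)].

Lemma vertex_relation_iff K s1 s2 phi u v : vertex_relation K ->
  is_oEFT s1 -> is_oEFT s2 -> riso s1 s2 phi -> vert s1 u -> vert s1 v ->
  K s1 u v <-> K s2 (phi u) (phi v).
Proof.
move=> [_ _ inv] H1 H2 phiP Vu Vv; split; first exact: inv.
have [psi [psiP psiK]] := riso_sym (eft_root H1) (fun v => eft_par H1 (v := v)) phiP.
move=> /(inv _ _ _ _ _ H2 H1 psiP); rewrite !psiK//; apply.
all: by case: phiP => _ [+ _ _ _ _]; apply.
Qed.

Definition targets (K : ostr -> int -> int -> Prop) (s : ostr) : set int :=
  [set u | vert s u /\ K s (root s) u].
Definition sources (K : ostr -> int -> int -> Prop) (s : ostr) : set int :=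
  [set u | vert s u /\ K s u (root s)].

Section MassTransport.
Local Open Scope ereal_scope.
Context (R : realType) (d : measure_display) (T : measurableType d).
Context (P : probability T R) (X : T -> Ostr).
Context (mX : measurable_fun [set: T] X) (oX : forall w, is_oEFT (X w)).
Context (uX : unimodular P X).

Lemma measurable_comp_X (A : set Ostr) : measurable A ->
  measurable [set w | A (X w)].
Proof. by move=> mA; rewrite -[X in measurable X]setTI; exact: mX. Qed.

Lemma measurable_targets K u : vertex_relation K ->
  measurable [set s : Ostr | targets K s u].
Proof.
move=> [_ mK _]; apply: measurable_and; first exact: measurable_vert.
rewrite (_ : [set s : Ostr | _] =
  [set s : Ostr | exists v, root s = v /\ K s v u]).
  apply: measurable_exists => v; apply: measurable_and => //.
  exact: measurable_root.
by apply/seteqP; split=> s /=; [move=> E; eexists|move=> [v [->]]].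
Qed.

Lemma measurable_sources K u : vertex_relation K ->
  measurable [set s : Ostr | sources K s u].
Proof.
move=> [_ mK _]; apply: measurable_and; first exact: measurable_vert.
rewrite (_ : [set s : Ostr | _] =
  [set s : Ostr | exists v, root s = v /\ K s u v]).
  apply: measurable_exists => v; apply: measurable_and => //.
  exact: measurable_root.
by apply/seteqP; split=> s /=; [move=> E; eexists|move=> [v [->]]].
Qed.

Lemma measurable_num_targets K : vertex_relation K ->
  measurable_fun setT (fun w => num R (targets K (X w))).
Proof.
move=> vK; apply: measurable_num => u.
exact: measurable_comp_X (measurable_targets u vK).
Qed.

Lemma measurable_num_sources K : vertex_relation K ->
  measurable_fun setT (fun w => num R (sources K (X w))).
Proof.
move=> vK; apply: measurable_num => u.
exact: measurable_comp_X (measurable_sources u vK).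
Qed.

Lemma mass_transport K : vertex_relation K ->
  \int[P]_w num R (targets K (X w)) = \int[P]_w num R (sources K (X w)).
Proof.
move=> vK; have [rK mK _] := vK.
pose h (s : ostr) u : \bar R := (\1_[set s : Ostr | targets K s u] s)%:E.
have hE (A Q : set int) (a : int -> \bar R) :
    (forall u, A u -> a u = if u \in Q then 1 else 0) ->
    \esum_(u in A) a u = num R (A `&` Q).
  by move=> aE; rewrite /num esum_mkcondr; exact: eq_esum.
transitivity (\int[P]_w (\esum_(u in [set u | vert (X w) u]) h (X w) u)).
  apply: eq_integral => w _; rewrite (hE _ [set u | K (X w) (root (X w)) u])// => u Vu.
  rewrite /h indicE; have [k|k] := pselect (K (X w) (root (X w)) u).
    by rewrite !mem_set.
  by rewrite !memNset// => -[].
rewrite uX.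
- apply: eq_integral => w _; rewrite (hE _ [set u | K (X w) u (root (X w))])// => u Vu.
  rewrite /h indicE; have [k|k] := pselect (K (X w) u (root (X w))).
    rewrite !mem_set//; split; first exact: eft_root.
    by rewrite rK.
  by rewrite !memNset// => -[_]; rewrite rK.
- by move=> s u; rewrite lee_fin.
- by move=> u; apply/measurable_EFinP/measurable_indic; exact: measurable_targets.
- move=> s1 s2 phi u H1 H2 phiP Vu; rewrite /h !indicE.
  have phiV : vert s2 (phi u) by case: phiP => _ [+ _ _ _ _]; apply.
  have e : targets K s1 u <-> targets K s2 (phi u).
    rewrite /targets /= -(proj1 phiP); split=> -[_ k]; split=> //.
      exact/(vertex_relation_iff vK H1 H2 phiP (eft_root H1) Vu).
    exact/(vertex_relation_iff vK H1 H2 phiP (eft_root H1) Vu).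
  have [k|k] := pselect (targets K s1 u).
    by rewrite !mem_set//; exact/e.
  by rewrite !memNset// => /e.
Qed.

Lemma int_num_le1 K : vertex_relation K ->
  {ae P, forall w, num R (targets K (X w)) <= 1} ->
  \int[P]_w num R (targets K (X w)) <= 1.
Proof.
move=> vK le1; have <- : \int[P]_w (cst 1) w = 1.
  by rewrite integral_cst// mul1e; exact: probability_setT.
apply: ae_ge0_le_integral => //.
- by move=> w _; exact: num_ge0.
- exact: measurable_num_targets.
- by apply: filterS le1 => w.
Qed.

(** The expected mass received equals the expected mass sent, here at most 1, so the mass received
    is almost surely finite. *)
Lemma finite_sources K : vertex_relation K ->
  {ae P, forall w, num R (targets K (X w)) <= 1} ->
  {ae P, forall w, finite_set (sources K (X w))}.
Proof.
move=> vK le1.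
have fi : P.-integrable setT (fun w => num R (sources K (X w))).
  apply/integrableP; split; first exact: measurable_num_sources.
  under eq_integral do rewrite gee0_abs ?num_ge0//.
  by rewrite -mass_transport// (le_lt_trans (int_num_le1 vK le1))// ltry.
have := integrable_ae measurableT fi; apply: filterS => w /(_ I).
exact: num_fin.
Qed.

(** The expected mass sent vanishes together with the expected mass received, and a nonnegative
    function with zero integral vanishes almost everywhere. *)
Lemma no_sources_no_targets K : vertex_relation K ->
  {ae P, forall w, sources K (X w) = set0} ->
  {ae P, forall w, targets K (X w) = set0}.
Proof.
move=> vK s0; have mt := measurable_num_targets vK.
have : ae_eq P setT (fun w => num R (targets K (X w))) (cst 0).
  apply/ae_eq_integral_abs => //.
  under eq_integral do rewrite gee0_abs ?num_ge0//.
  rewrite mass_transport// -[RHS](integral0 P setT).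
  apply: ae_eq_integral => //; first exact: measurable_num_sources.
  by apply: filterS s0 => w -> _; rewrite num0.
by apply: filterS => w /(_ I) /num_eq0.
Qed.

(** Let every vertex send mass to all vertices satisfying [Q]: the root receives nothing, hence
    sends nothing, and no vertex satisfies [Q]. *)
Lemma root_to_vertices (Q : ostr -> int -> Prop) :
  vertex_relation (fun s _ v => Q s v) ->
  {ae P, forall w, ~ Q (X w) (root (X w))} ->
  {ae P, forall w, forall v, vert (X w) v -> ~ Q (X w) v}.
Proof.
move=> vQ nQ; have := @no_sources_no_targets _ vQ.
have s0 : {ae P, forall w, sources (fun s _ v => Q s v) (X w) = set0}.
  by apply: filterS nQ => w nQ; apply/seteqP; split=> u //= [].
move=> /(_ s0); apply: filterS => w t0 v Vv Qv.
suff : targets (fun s _ v => Q s v) (X w) v by rewrite t0.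
by [].
Qed.

(** The root never receives less than it sends, and on [Q] at least one unit more. Equal
    expectations force [Q] to have probability zero. *)
Lemma mass_transport_excess K (Q : ostr -> int -> Prop) : vertex_relation K ->
  measurable [set w | Q (X w) (root (X w))] ->
  (forall w, num R (targets K (X w)) <= 1) ->
  (forall w, num R (targets K (X w)) <= num R (sources K (X w))) ->
  (forall w, Q (X w) (root (X w)) ->
     num R (targets K (X w)) + 1 <= num R (sources K (X w))) ->
  {ae P, forall w, ~ Q (X w) (root (X w))}.
Proof.
move=> vK mQ le1 le gap; set E := [set w | _] in mQ.
have mI : measurable_fun setT (fun w => (\1_E w)%:E : \bar R).
  exact/measurable_EFinP/measurable_indic.
have mt := measurable_num_targets vK.
have : \int[P]_w (num R (targets K (X w)) + (\1_E w)%:E) <=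
       \int[P]_w num R (targets K (X w)).
  rewrite [leRHS]mass_transport//; apply: ge0_le_integral => //.
  - by move=> w _; rewrite adde_ge0 ?num_ge0// lee_fin.
  - exact: emeasurable_funD.
  - exact: measurable_num_sources.
  - move=> w _; rewrite indicE; have [q|q] := pselect (E w).
      by rewrite mem_set//; exact: gap.
    by rewrite memNset// adde0.
rewrite ge0_integralD//; last by move=> w _; exact: num_ge0.
rewrite integral_indic// setIT.
(* Finiteness allows this integral to be cancelled from both sides. *)
have fi : \int[P]_w num R (targets K (X w)) \is a fin_num.
  rewrite ge0_fin_numE ?integral_ge0//; last by move=> w _; exact: num_ge0.
  by rewrite (le_lt_trans (int_num_le1 vK _)) ?ltry//; exact: aeW.
rewrite -[leRHS]adde0 leeD2lE// => E0; exists E; split=> //.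
  by apply/eqP; rewrite eq_le E0 measure_ge0.
by move=> w /contrapT.
Qed.

End MassTransport.

(** * Invariance and measurability of the notions attached to the line *)

(** A cylinder event of the offspring sequence, read from [v] instead of from the root, so that it
    can enter a mass transport. *)
Definition block (L : nat) (a : nat -> int) (s : ostr) (v : int) : Prop :=
  forall k, (k < L)%N ->
    exists x, shift s (k%:Z + 1) v x /\ nchild s x (a k + 1).

Section Isomorphism.
Context (s1 s2 : ostr) (phi : int -> int).
Context (H1 : is_oEFT s1) (H2 : is_oEFT s2) (phiP : riso s1 s2 phi).

Lemma riso_vert u : vert s1 u -> vert s2 (phi u).
Proof. by case: phiP => _ [+ _ _ _ _]; apply. Qed.

Lemma riso_surj w : vert s2 w -> exists2 v, vert s1 v & phi v = w.
Proof. by case: phiP => _ [_ _ + _ _]; apply. Qed.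

Lemma riso_inj u v : vert s1 u -> vert s1 v -> phi u = phi v -> u = v.
Proof. by case: phiP => _ [_ + _ _ _]; apply. Qed.

Lemma riso_par u : vert s1 u -> phi (par s1 u) = par s2 (phi u).
Proof. by case: phiP => _ [_ _ _ + _]; apply. Qed.

Lemma riso_iter n u : vert s1 u ->
  phi (iter n (par s1) u) = iter n (par s2) (phi u).
Proof.
by move=> Vu; elim: n => //= n <-; apply/riso_par/eft_iter.
Qed.

Lemma riso_prec u v : vert s1 u -> vert s1 v ->
  prec s1 u v -> prec s2 (phi u) (phi v).
Proof.
move=> Vu Vv [[k [k0 ->]]|[m [n [E L]]]].
  by left; exists k; split=> //; exact: riso_iter.
right; exists m, n; rewrite -!riso_iter// E; split=> //.
move: L; case: phiP => _ [_ _ _ _ ->] //; exact: eft_iter.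
Qed.

Lemma riso_prec_iff u v : vert s1 u -> vert s1 v ->
  prec s1 u v <-> prec s2 (phi u) (phi v).
Proof.
move=> Vu Vv; split; first exact: riso_prec.
have [e|[//|vu]] := prec_total H1 Vu Vv.
  by rewrite e => /(prec_irr H2 (riso_vert Vv)).
move=> /(prec_asym H2 (riso_vert Vu) (riso_vert Vv)) [].
exact: riso_prec.
Qed.

Lemma riso_least u : least s1 u -> least s2 (phi u).
Proof.
move=> [Vu lu]; split; first exact: riso_vert.
move=> _ /riso_surj[v Vv <-]; have [->|h] := lu _ Vv; first by left.
by right; exact: riso_prec.
Qed.

Lemma riso_nxt u v : nxt s1 u v -> nxt s2 (phi u) (phi v).
Proof.
move=> [Vu Vv uv mv]; split; [exact: riso_vert..|exact: riso_prec|].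
move=> _ /riso_surj[w Vw <-] /(riso_prec_iff Vu Vw) /(mv _ Vw)[->|h]; first by left.
by right; exact: riso_prec.
Qed.

Lemma riso_chain n u v : chain s1 n u v -> chain s2 n (phi u) (phi v).
Proof.
elim: n u => [u ->//|n IH u [w [uw /IH wv]]].
by exists (phi w); split=> //; exact: riso_nxt.
Qed.

Lemma riso_shift m u v : shift s1 m u v -> shift s2 m (phi u) (phi v).
Proof. by case: m => n; exact: riso_chain. Qed.

Lemma riso_nchild v c : vert s1 v -> nchild s1 v c -> nchild s2 (phi v) c.
Proof.
move=> Vv [l [ul <- lP]]; exists (map phi l); split.
- rewrite map_inj_in_uniq// => x y /lP[Vx _] /lP[Vy _]; exact: riso_inj.
- by rewrite size_map.
- move=> w; split=> [/mapP[u /lP[Vu <-] ->]|[]].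
    by split; [exact: riso_vert|rewrite riso_par].
  move=> /riso_surj[u Vu <-]; rewrite -riso_par// => E.
  apply: map_f; apply/lP; split=> //.
  by apply: riso_inj => //; exact: (eft_par H1).
Qed.

Lemma riso_block L a v : vert s1 v -> block L a s1 v -> block L a s2 (phi v).
Proof.
move=> Vv b k kL; have [x [vx xc]] := b k kL; exists (phi x); split.
  exact: riso_shift.
by apply: riso_nchild => //; exact: shift_vert vx.
Qed.

End Isomorphism.

Section VertexRelations.

Lemma measurable_least v : measurable [set s : Ostr | least s v].
Proof.
apply: measurable_and; first exact: measurable_vert.
apply: measurable_forall => w; apply: measurable_imply; first exact: measurable_vert.
by apply: measurable_or; [exact: measurable_prop|exact: measurable_prec].
Qed.

Lemma measurable_nxt u v : measurable [set s : Ostr | nxt s u v].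
Proof.
rewrite (_ : [set s : Ostr | _] = [set s : Ostr | vert s u /\ (vert s v /\
  (prec s u v /\ forall w, vert s w -> prec s u w -> w = v \/ prec s v w))]).
  do 3 (apply: measurable_and;
    first by [exact: measurable_vert|exact: measurable_prec]).
  apply: measurable_forall => w; apply: measurable_imply; first exact: measurable_vert.
  apply: measurable_imply; first exact: measurable_prec.
  by apply: measurable_or; [exact: measurable_prop|exact: measurable_prec].
by apply/seteqP; split=> s /=; [case|case=> ? [? [? ?]]].
Qed.

Lemma measurable_chain n u v : measurable [set s : Ostr | chain s n u v].
Proof.
elim: n u => [|n IH] u; first exact: measurable_prop.
apply: measurable_exists => w; apply: measurable_and; last exact: IH.
exact: measurable_nxt.
Qed.

Lemma measurable_shift m u v : measurable [set s : Ostr | shift s m u v].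
Proof. by case: m => n; exact: measurable_chain. Qed.

Lemma measurable_nchild v c : measurable [set s : Ostr | nchild s v c].
Proof.
rewrite (_ : [set s : Ostr | _] = [set s : Ostr | exists l : seq int,
  (uniq l /\ (size l)%:Z = c) /\ forall u,
     (u \in l -> vert s u /\ par s u = v) /\
     (vert s u /\ par s u = v -> u \in l)]).
  apply: measurable_exists => l; apply: measurable_and; first exact: measurable_prop.
  apply: measurable_forall => u.
  by apply: measurable_and; apply: measurable_imply;
    by [exact: measurable_prop|apply: measurable_and;
        [exact: measurable_vert|exact: measurable_par]].
apply/seteqP; split=> s /=.
  move=> [l [ul cl lP]]; by exists l; split.
by move=> [l [[ul cl] lP]]; exists l; split.
Qed.

Lemma measurable_block L a v : measurable [set s : Ostr | block L a s v].
Proof.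
apply: measurable_forall => k; apply: measurable_imply; first exact: measurable_prop.
apply: measurable_exists => x; apply: measurable_and; first exact: measurable_shift.
exact: measurable_nchild.
Qed.

Lemma shift_reroot s x : shift (reroot s x) = shift s.
Proof.
have chainE n : chain (reroot s x) n = chain s n.
  by elim: n => // n IH; apply/funext => u; apply/funext => v /=; rewrite IH.
by apply/funext => -[n|n]; rewrite /shift ?chainE//; apply/funext => u; apply/funext => v.
Qed.

Lemma vertex_relation_least : vertex_relation (fun s _ v => least s v).
Proof.
split=> //; first by move=> _ v; exact: measurable_least.
by move=> s1 s2 phi u v H1 H2 phiP _ _; exact: riso_least.
Qed.

Lemma vertex_relation_shift_nchild m c :
  vertex_relation (fun s u v => shift s m u v /\ nchild s v c).
Proof.
split.
- by move=> s x; rewrite shift_reroot.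
- move=> u v; apply: measurable_and; first exact: measurable_shift.
  exact: measurable_nchild.
- move=> s1 s2 phi u v H1 H2 phiP Vu Vv [uv vc].
  by split; [exact: (riso_shift H1 H2 phiP)|exact: (riso_nchild H1 phiP)].
Qed.

Lemma vertex_relation_shift_block m L a :
  vertex_relation (fun s u v => shift s m u v /\ block L a s v).
Proof.
split.
- by move=> s x; rewrite /block shift_reroot.
- move=> u v; apply: measurable_and; first exact: measurable_shift.
  exact: measurable_block.
- move=> s1 s2 phi u v H1 H2 phiP Vu Vv [uv vc].
  by split; [exact: (riso_shift H1 H2 phiP)|exact: (riso_block H1 H2 phiP)].
Qed.

End VertexRelations.

Lemma block_offspring s f i L a : is_oEFT s -> order_iso s f -> f 0 = root s ->
  block L a s (f i) <-> forall k, (k < L)%N -> offspring s (i + k%:Z) = a k.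
Proof.
move=> Hs Hf f0; have Vf n : vert s (f n) by case: Hf.
split=> b k kL.
  have [x [sx nx]] := b k kL.
  have Vx : vert s x by exact: shift_vert sx.
  apply/(offspringP Hs Hf f0); move: sx => /(order_iso_shift Hs Hf _ _ Vx) xE.
  by rewrite -addrA -xE.
exists (f (i + (k%:Z + 1))); split; first exact/(order_iso_shift Hs Hf).
by rewrite addrA; apply/(offspringP Hs Hf f0); exact: b.
Qed.

Lemma infinite_vert s : is_oEFT s -> infinite_set [set u | vert s u].
Proof.
move=> Hs /finite_seqP[l lE]; have Vr := eft_root Hs.
pose t := [seq iter k (par s) (root s) | k <- iota 0 (size l).+1].
have : (size t <= size l)%N.
  apply: uniq_leq_size.
    by rewrite map_inj_uniq ?iota_uniq// => m n; exact: iter_par_inj.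
  move=> u /mapP[k _ ->]; suff : [set` l] (iter k (par s) (root s)) by [].
  by rewrite -lE; exact: eft_iter.
by rewrite size_map size_iota ltnn.
Qed.

Lemma eq_measure_ae d (T : measurableType d) (R : realType)
    (P : probability T R) (A B : set T) : measurable A -> measurable B ->
  {ae P, forall w, A w <-> B w} -> P A = P B.
Proof.
move=> mA mB AB.
rewrite -[A]setIT -[B]setIT -!integral_indic//.
apply: ae_eq_integral => //; [exact/measurable_EFinP/measurable_indic..|].
apply: filterS AB => w AB _; rewrite !indicE.
have [h|h] := pselect (A w); first by rewrite !mem_set//; exact/AB.
by rewrite !memNset// => /AB.
Qed.

(** * Stationarity of the offspring sequence and equality of laws *)

Section Representation.
Local Open Scope ereal_scope.
Context (R : realType) (d : measure_display) (T : measurableType d).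
Context (P : probability T R) (X : T -> Ostr).
Context (mX : measurable_fun [set: T] X) (oX : forall w, is_oEFT (X w)).
Context (uX : unimodular P X).

(** Every vertex sends unit mass to the least vertex, if there is one. A least root would receive
    mass from all of the infinitely many vertices, but the mass received is almost surely finite. *)
Lemma no_least : {ae P, forall w, forall v, ~ least (X w) v}.
Proof.
have fin := finite_sources mX oX uX vertex_relation_least.
have le1 : {ae P, forall w, num R (targets (fun s _ v => least s v) (X w)) <= 1}.
  apply: aeW => w; apply: num_le1 => x y [Vx [_ lx]] [Vy [_ ly]].
  have [//|xy] := lx _ Vy; have [//|yx] := ly _ Vx.
  by case: (prec_asym (oX w) Vx Vy xy).
have nl : {ae P, forall w, ~ least (X w) (root (X w))}.
  apply: filterS (fin le1) => w fs lr; apply: (infinite_vert (oX w)).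
  by apply: sub_finite_set fs => u Vu; split.
have := root_to_vertices mX oX uX vertex_relation_least nl.
by apply: filterS => w h v lv; have [Vv _] := lv; exact: (h v).
Qed.

Lemma usl_representable : {ae P, forall w, unique_succession_line (X w)} ->
  record_representable P X.
Proof.
move=> usl.
have [N [mN N0 NG]] : {ae P, forall w,
    exists f, order_iso (X w) f /\ f 0%R = root (X w)}.
  by apply: filterS2 usl no_least => w; exact: usl_order_iso.
have good w : ~ N w -> exists f, order_iso (X w) f /\ f 0%R = root (X w).
  by move=> nN; apply: contrapT => ng; apply: nN; exact: NG.
(* [Y] is constant on the null set [N]: an event on [rec_tree (Y w)] is then
   measurable, since it agrees with an event on [X w] outside [N]. *)
pose Y w n : int := if pselect (N w) then 0%R else offspring (X w) n.
have YE w n : ~ N w -> Y w n = offspring (X w) n by rewrite /Y; case: pselect.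
have YN w n : N w -> Y w n = 0%R by rewrite /Y; case: pselect.
have aeN (Q : T -> Prop) : (forall w, ~ N w -> Q w) -> {ae P, forall w, Q w}.
  by move=> NQ; exists N; split=> // w; apply: contra_notP; exact: NQ.
have mY n k : measurable [set w | Y w n = k].
  pose K s u v := shift s (n + 1)%R u v /\ nchild s v (k + 1)%R.
  rewrite (_ : [set w | _] = [set w | (N w /\ 0%R = k) \/
      (~ N w /\ exists u, targets K (X w) u)]).
    apply: measurable_or; apply: measurable_and => //.
    - exact: measurable_prop.
    - exact: measurable_not.
    apply: measurable_exists => u.
    apply: (measurable_comp_X mX (A := [set s : Ostr | targets K s u])).
    exact: measurable_targets (vertex_relation_shift_nchild _ _).
  have key w : ~ N w -> Y w n = k <-> exists u, targets K (X w) u.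
    move=> nN; have [f [Hf f0]] := good _ nN; rewrite YE// (offspringP (oX w) Hf f0).
    split=> [nc|[u [Vu []]]].
      exists (f (n + 1)%R); split; first by case: Hf.
      split=> //; rewrite -f0; apply/(order_iso_shift (oX w) Hf); last by rewrite add0r.
      by case: Hf.
    by rewrite -f0 => /(order_iso_shift (oX w) Hf _ _ Vu) ->; rewrite add0r.
  apply/seteqP; split=> w /=; have [h|h] := pselect (N w).
  - by rewrite YN// => <-; left.
  - by move=> /(key _ h) e; right.
  - by rewrite YN// => -[[]|[]].
  - by move=> [[]//|[_ e]]; exact/key.
exists d, T, P, Y; split.
- split=> // L a m.
  have mE i : measurable [set w | forall k, (k < L)%N -> Y w (i + k%:Z)%R = a k].
    apply: measurable_forall => k; apply: measurable_imply => //.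
    exact: measurable_prop.
  have E0 : [set w | forall k, (k < L)%N -> Y w k%:Z = a k] =
            [set w | forall k, (k < L)%N -> Y w (0 + k%:Z)%R = a k].
    by apply/funext => w; under [RHS]eq_forall do rewrite add0r.
  rewrite E0.
  (* Each vertex sends mass [m] steps along the line if the word [a] is read at the arrival. The
     root sends one unit exactly when [a] is read at position [m], and receives one, from position
     [-m], exactly when [a] is read at position 0. *)
  pose K s u v := shift s m u v /\ block L a s v.
  have vK : vertex_relation K := vertex_relation_shift_block m L a.
  (* The set over [unit] serves to write the indicator of a bare proposition [b]. *)
  have numE (A : set int) (x : int) (b : Prop) : (forall u, A u <-> u = x /\ b) ->
      num R A = (\1_[set _ : unit | b] tt)%:E.
    move=> AE; rewrite indicE; have [h|h] := pselect b.
      rewrite mem_set// -[RHS](num1 R x); congr num.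
      by apply/seteqP; split=> u; [move/AE => [->]|move=> ->; exact/AE].
    rewrite memNset// -[RHS](num0 R); congr num.
    by apply/seteqP; split=> u // /AE[].
  have EE w i f : ~ N w -> order_iso (X w) f -> f 0%R = root (X w) ->
      block L a (X w) (f i) <-> forall k, (k < L)%N -> Y w (i + k%:Z)%R = a k.
    move=> nN Hf f0; rewrite (block_offspring i L a (oX w) Hf f0).
    by split=> h k kL; [rewrite YE//|rewrite -YE//]; exact: h.
  have indE w i f : ~ N w -> order_iso (X w) f -> f 0%R = root (X w) ->
      (\1_[set _ : unit | block L a (X w) (f i)] tt)%:E =
      (\1_[set w | forall k, (k < L)%N -> Y w (i + k%:Z)%R = a k] w)%:E :> \bar R.
    move=> nN Hf f0; have e := EE w i f nN Hf f0; rewrite !indicE.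
    have [h|h] := pselect (block L a (X w) (f i)).
      by rewrite !mem_set//; exact/e.
    by rewrite !memNset// => /e.
  rewrite -[X in P X]setIT -[X in _ = P X]setIT -!integral_indic//.
  transitivity (\int[P]_w num R (targets K (X w))).
    apply: ae_eq_integral => //.
    + exact/measurable_EFinP/measurable_indic.
    + exact: measurable_num_targets.
    apply: aeN => w nN _; have [f [Hf f0]] := good _ nN.
    rewrite -(indE _ _ f)//; apply/esym/(numE _ (f m)) => u; split.
      move=> [Vu []]; rewrite -f0 => /(order_iso_shift (oX w) Hf _ _ Vu).
      by rewrite add0r => ->.
    have Vf : vert (X w) (f m) by case: Hf.
    move=> [-> b]; split=> //; split=> //.
    by rewrite -f0; apply/(order_iso_shift (oX w) Hf) => //; rewrite add0r.
  rewrite (mass_transport oX uX vK).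
  apply: ae_eq_integral => //.
  + exact: measurable_num_sources.
  + exact/measurable_EFinP/measurable_indic.
  apply: aeN => w nN _; have [f [Hf f0]] := good _ nN.
  rewrite -(indE _ _ f)//; apply/(numE _ (f (- m)%R)) => u; split.
    move=> [Vu []]; have [i <-] : exists i, f i = u by case: Hf => _ + _; apply.
    rewrite -f0 => /(order_iso_shift (oX w) Hf) h b; split=> //; congr f.
    have V0 : vert (X w) (f 0%R) by case: Hf.
    by have := order_iso_inj (oX w) Hf (h V0); lia.
  have Vf i : vert (X w) (f i) by case: Hf.
  move=> [-> b]; split=> //; rewrite -f0; split=> //.
  by apply/(order_iso_shift (oX w) Hf) => //; rewrite addNr.
- move=> w n; rewrite /Y; case: pselect => // nN.
  have [f [Hf f0]] := good _ nN; exact: (offspring_ge (oX w) Hf f0).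
- move=> A mA cA.
  have key w : ~ N w -> A (X w) <-> A (rec_tree (Y w)).
    move=> nN; have [f [Hf f0]] := good _ nN.
    have -> : Y w = offspring (X w) by apply/funext => n; exact: YE.
    have fP := rec_tree_riso (oX w) Hf f0.
    split; last exact: cA fP.
    (* [iso_closed] transfers an event only in the direction of the isomorphism, so the converse
       takes the inverse. *)
    have [||psi [psiP _]] := riso_sym _ _ fP.
    + exact: (rec_tree_connected (oX w) Hf f0).
    + by move=> v _; exact: (rec_tree_connected (oX w) Hf f0).
    + exact: cA psiP.
  have mXA : measurable (X @^-1` A) by exact: measurable_comp_X.
  apply: eq_measure_ae => //; last exact: aeN.
  rewrite (_ : _ @^-1` A = [set w | (~ N w /\ A (X w)) \/
      (N w /\ A (rec_tree (fun=> 0%R)))]).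
    apply: measurable_or; apply: measurable_and => //; first exact: measurable_not.
    exact: measurable_prop.
  have Y0 w : N w -> Y w = (fun=> 0%R) by move=> h; apply/funext => n; exact: YN.
  apply/seteqP; split=> w /=; have [h|h] := pselect (N w).
  - by rewrite Y0//; right.
  - by move/(key _ h); left.
  - by rewrite Y0// => -[[]//|[]].
  - by move=> [[_ /(key _ h)]//|[]].
Qed.

End Representation.

(** * Vertices with descendants in every generation *)

Definition deep (s : ostr) (u : int) : Prop :=
  forall n, exists x, vert s x /\ iter n (par s) x = u.

Definition forked (s : ostr) (v : int) : Prop :=
  exists u w, u <> w /\
    (deep s u /\ par s u = v) /\ (deep s w /\ par s w = v).

Section Deep.
Context (s : ostr) (Hs : is_oEFT s).
Local Notation F := (par s).
Local Notation V := (vert s).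

Lemma deep_vert u : deep s u -> V u.
Proof. by move=> /(_ 0%N)[x [Vx <-]]. Qed.

Lemma deep_par u : deep s u -> deep s (F u).
Proof.
move=> du [|n]; first by exists (F u); split=> //; exact/(eft_par Hs)/deep_vert.
by have [x [Vx <-]] := du n; exists x.
Qed.

(** If no child were deep, each of the finitely many children [u] would have an empty generation
    [N u]. A descendant of [v] one generation beyond the maximum of [N] passes through some child
    and contradicts its bound. *)
Lemma deep_child v : deep s v -> exists u, deep s u /\ F u = v.
Proof.
move=> dv; apply: contrapT => nex.
have /finite_seqP[l lE] := eft_finite_children Hs (deep_vert dv).
have lP u : u \in l <-> V u /\ F u = v.
  by have := congr1 (fun A : set int => A u) lE => /= ->.
have /choice[N NP] u : exists n, u \in l -> forall x, V x -> iter n F x <> u.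
  have [ul|_] := boolP (u \in l); last by exists 0%N.
  have [Vu Fu] := proj1 (lP u) ul; apply: contrapT => nn; apply: nex.
  exists u; split=> // n; apply: contrapT => nx; apply: nn; exists n => _ x Vx E.
  by apply: nx; exists x.
have [x [Vx xv]] := dv (\max_(u <- l) N u).+1.
pose M := (\max_(u <- l) N u)%N.
have ul : iter M F x \in l by apply/lP; split=> //; exact: eft_iter.
have NM : (N (iter M F x) <= M)%N by exact: leq_bigmax_seq.
apply: (NP _ ul (iter (M - N (iter M F x)) F x)); first exact: eft_iter.
by rewrite -iterD subnKC.
Qed.

Lemma finite_generation k v : V v -> finite_set [set u | V u /\ iter k F u = v].
Proof.
elim: k v => [|k IH] v Vv.
  by apply: (sub_finite_set _ (finite_set1 v)) => u [].
pose C := [set u | V u /\ F u = v].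
apply: (@sub_finite_set _ _ (\bigcup_(c in C) [set u | V u /\ iter k F u = c])).
  move=> u [Vu E]; exists (iter k F u) => //; split=> //; exact: eft_iter.
by apply: bigcup_finite; [exact: eft_finite_children|move=> c [Vc _]; exact: IH].
Qed.

(** Once generation [n] is empty, so are all later ones, and each of the finitely many earlier ones
    is finite. *)
Lemma finite_descendants v : V v -> ~ deep s v ->
  finite_set [set u | V u /\ anc s u v].
Proof.
move=> Vv /existsNP[n nn].
apply: (@sub_finite_set _ _
    (\bigcup_(k in `I_n) [set u | V u /\ iter k F u = v])).
  move=> u [Vu [k [_ E]]]; exists k => //=; rewrite ltnNge; apply/negP => nk.
  apply: nn; exists (iter (k - n) F u); split; first exact: eft_iter.
  by rewrite -iterD subnKC.
by apply: bigcup_finite => // k _; exact: finite_generation.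
Qed.

(** The parents are deep too and meet one generation sooner, so they coincide by induction; without
    forks, so do [u] and [v]. *)
Lemma deep_unique_in_foil u v n : (forall x, V x -> ~ forked s x) ->
  deep s u -> deep s v -> iter n F u = iter n F v -> u = v.
Proof.
move=> nf; elim: n u v => //= n IH u v du dv E.
have e : F u = F v by apply: IH; [exact: deep_par|exact: deep_par|rewrite -!iterSr].
apply: contrapT => uv; apply: (nf (F v)); first exact/deep_vert/deep_par.
by exists u, v.
Qed.

End Deep.

Lemma riso_deep s1 s2 phi u : is_oEFT s1 -> riso s1 s2 phi ->
  deep s1 u -> deep s2 (phi u).
Proof.
move=> H1 phiP du n; have [x [Vx <-]] := du n.
by exists (phi x); split; [exact: (riso_vert phiP)|rewrite (riso_iter H1 phiP)].
Qed.

Lemma measurable_deep u : measurable [set s : Ostr | deep s u].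
Proof.
apply: measurable_forall => n; apply: measurable_exists => x.
by apply: measurable_and; [exact: measurable_vert|exact: measurable_iter].
Qed.

Lemma vertex_relation_deep : vertex_relation (fun s _ v => deep s v).
Proof.
split=> //; first by move=> _ v; exact: measurable_deep.
by move=> s1 s2 phi _ v H1 _ phiP _ _; exact: (riso_deep H1 phiP).
Qed.

Lemma vertex_relation_deep_par :
  vertex_relation (fun s u v => deep s u /\ par s u = v).
Proof.
split=> //.
  move=> u v; apply: measurable_and; first exact: measurable_deep.
  exact: measurable_par.
move=> s1 s2 phi u v H1 _ phiP Vu Vv [du <-]; split.
  exact: (riso_deep H1 phiP).
by rewrite (riso_par phiP).
Qed.

Lemma vertex_relation_forked : vertex_relation (fun s _ v => forked s v).
Proof.
have [_ mK iK] := vertex_relation_deep_par; split=> //.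
  move=> _ v; apply: measurable_exists => u; apply: measurable_exists => w.
  apply: measurable_and; first exact: measurable_prop.
  by apply: measurable_and; exact: mK.
move=> s1 s2 phi _ v H1 H2 phiP _ Vv [u [w [uw [du dw]]]].
have Vu := deep_vert du.1; have Vw := deep_vert dw.1.
exists (phi u), (phi w); split; first by move/(riso_inj phiP Vu Vw).
by split; [exact: iK du|exact: iK dw].
Qed.

Lemma vertex_relation_deep_foil : vertex_relation
  (fun s u v => deep s v /\ exists n, (0 < n)%N /\ iter n (par s) u = iter n (par s) v).
Proof.
split=> //.
  move=> u v; apply: measurable_and; first exact: measurable_deep.
  apply: measurable_exists => n; apply: measurable_and; first exact: measurable_prop.
  exact: measurable_iter2.
move=> s1 s2 phi u v H1 H2 phiP Vu Vv [dv [n [n0 E]]].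
split; first exact: (riso_deep H1 phiP).
by exists n; split=> //; rewrite -!(riso_iter H1 phiP)// E.
Qed.

(** * Absence of deep vertices in class I/I *)

Section ClassII.
Local Open Scope ereal_scope.
Context (R : realType) (d : measure_display) (T : measurableType d).
Context (P : probability T R) (X : T -> Ostr).
Context (mX : measurable_fun [set: T] X) (oX : forall w, is_oEFT (X w)).
Context (uX : unimodular P X).

(** Each deep vertex sends unit mass to its parent. A deep vertex receives at least the unit it
    sends, from a deep child, and a forked vertex receives at least two. *)
Lemma no_forked : {ae P, forall w, forall v, vert (X w) v -> ~ forked (X w) v}.
Proof.
apply: (root_to_vertices mX oX uX vertex_relation_forked).
have vK := vertex_relation_deep_par.
have t1 w : num R (targets (fun s u v => deep s u /\ par s u = v) (X w)) <= 1.
  by apply: num_le1 => x y [_ [_ <-]] [_ [_ <-]].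
apply: (mass_transport_excess mX oX uX vK) => //.
- rewrite (_ : [set w | _] =
      [set w | exists v, root (X w) = v /\ forked (X w) v]).
    apply: measurable_exists => v.
    apply: (measurable_comp_X mX (A := [set s : Ostr | root s = v /\ forked s v])).
    apply: measurable_and; first exact: measurable_root.
    by case: vertex_relation_forked => _ /(_ 0%R v).
  by apply/seteqP; split=> w /=; [move=> E; eexists|move=> [v [->]]].
- move=> w; have [dr|ndr] := pselect (deep (X w) (root (X w))); last first.
    rewrite (_ : targets _ _ = set0) ?num0 ?num_ge0//.
    by apply/seteqP; split=> u // [_ []].
  have [c [dc cr]] := deep_child (oX w) dr.
  apply: (le_trans (t1 w)); rewrite -(num1 R c); apply: le_num => _ ->.
  by split=> //; exact: deep_vert.
- move=> w [u [v [uv [du dv]]]].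
  apply: (@le_trans _ _ (1 + 1)); first exact: leeD2r.
  apply: (@num_ge2 _ _ u v) => //; split=> //.
    exact: deep_vert du.1.
  exact: deep_vert dv.1.
Qed.

(** Each vertex sends unit mass to the deep vertices of its foil, almost surely at most one. A deep
    root would receive mass from its whole infinite foil. *)
Lemma class_II_usl : {ae P, forall w, class_II (X w)} ->
  {ae P, forall w, unique_succession_line (X w)}.
Proof.
move=> cII; have vK := vertex_relation_deep_foil.
have fin := finite_sources mX oX uX vK.
have nd : {ae P, forall w, ~ deep (X w) (root (X w))}.
  have {}fin := fin _; apply: filterS2 cII (fin _) => [w cw|].
    move=> fs dr; apply: (cw _ (eft_root (oX w))).
    apply: sub_finite_set fs => u [Vu [n [n0 E]]]; split=> //; split=> //.
    by exists n; split.
  apply: filterS no_forked => w nf; apply: num_le1 => x y.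
  move=> [_ [dx [m [_ Em]]]] [_ [dy [n [_ En]]]].
  (* [x] meets the root at height [m] and [y] at height [n]; at height [n + m] all three have the
     same ancestor. *)
  apply: (deep_unique_in_foil (oX w) nf dx dy (n := (n + m)%N)).
  by rewrite iterD -Em -iterD addnC iterD En -iterD addnC.
have := root_to_vertices mX oX uX vertex_relation_deep nd.
apply: filterS => w h; apply: (finite_descendants_usl (oX w)) => v Vv.
exact: (finite_descendants (oX w) Vv (h v Vv)).
Qed.

End ClassII.

Theorem theorem5p1 (R : realType) :
  (forall (d : measure_display) (T : measurableType d)
          (P : probability T R) (X : T -> Ostr),
     measurable_fun [set: T] X ->
     (forall w, is_oEFT (X w)) ->
     unimodular P X ->
     {ae P, forall w, unique_succession_line (X w)} ->
     record_representable P X) /\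
  (forall (d : measure_display) (T : measurableType d)
          (P : probability T R) (X : T -> Ostr),
     measurable_fun [set: T] X ->
     (forall w, is_oEFT (X w)) ->
     unimodular P X ->
     {ae P, forall w, class_II (X w)} ->
     record_representable P X).
Proof.
split=> d T P X mX oX uX h; first exact: usl_representable.
by apply: usl_representable => //; exact: class_II_usl.
Qed.
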